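(* Let $X$ and $Y$ be independent real random variables with $X \in \mathcal{D}^-$ and $Y \in \mathcal{D}^-$, and let $\phi:\mathbb{R}^2\to\mathbb{R}$ be increasing (componentwise non-decreasing) and convex. Then $\phi(X,Y)\in\mathcal{D}^-$.
   Context: For real random variables, $X \le_{st} Y$ means $P(X\le t)\ge P(Y\le t)$ for all $t\in\mathbb{R}$. A real random variable $X$ (equivalently its distribution function $F_X$) belongs to $\mathcal{D}^-$ if for every $n\in\mathbb{N}$, all $\theta_1,\dots,\theta_n\ge 0$ with $\sum_{i=1}^n\theta_i=1$, and i.i.d. random variables $X_1,\dots,X_n$ with distribution $F_X$, we have $X_1\le_{st}\sum_{i=1}^n\theta_iX_i$. *)

(* Defs.v *)
From HB Require Import structures.
From mathcomp Require Import all_boot all_order all_algebra.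
From mathcomp Require Import all_classical all_reals all_analysis.
Set Implicit Arguments. Unset Strict Implicit. Unset Printing Implicit Defensive.
Import Order.TTheory GRing.Theory Num.Theory.
Local Open Scope classical_set_scope.
Local Open Scope ring_scope.

Definition mutually_independent {R : realType} {d : measure_display}
  {T : measurableType d} (P : probability T R) (n : nat)
  (X : 'I_n -> T -> R) : Prop :=
  forall B : 'I_n -> set R, (forall i, measurable (B i)) ->
    P (\bigcap_(i in [set: 'I_n]) (X i @^-1` B i)) =
    (\prod_(i < n) P (X i @^-1` B i))%E.

Definition independent2 {R : realType} {d : measure_display}
  {T : measurableType d} (P : probability T R) (X Y : T -> R) : Prop :=
  forall A B : set R, measurable A -> measurable B ->
    P (X @^-1` A `&` Y @^-1` B) = (P (X @^-1` A) * P (Y @^-1` B))%E.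

Definition cdf {R : realType} {d : measure_display} {T : measurableType d}
  (P : probability T R) (X : T -> R) (t : R) : \bar R :=
  P [set w | X w <= t].

Definition st_le {R : realType} {d : measure_display} {T : measurableType d}
  (P : probability T R) (X Y : T -> R) : Prop :=
  forall t : R, (cdf P Y t <= cdf P X t)%E.

(* The class D^- : Z is a real random variable on (T, P) such that for every
   n >= 1, all weights theta_1..theta_n >= 0 summing to 1 and all i.i.d.
   X_1..X_n (on any probability space) with distribution function F_Z,
   X_1 <=_st sum_i theta_i X_i.  (Indices are 'I_n.+1, i.e. n+1 >= 1 variables;
   n = 0 variables is impossible since the weights sum to 1.) *)
Definition Dminus {R : realType} {d : measure_display} {T : measurableType d}
  (P : probability T R) (Z : T -> R) : Prop :=
  measurable_fun setT Z /\
  forall (n : nat) (theta : 'I_n.+1 -> R),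
    (forall i, 0 <= theta i) -> \sum_(i < n.+1) theta i = 1 ->
    forall (d' : measure_display) (T' : measurableType d')
           (P' : probability T' R) (X : 'I_n.+1 -> T' -> R),
      (forall i, measurable_fun setT (X i)) ->
      (forall i t, cdf P' (X i) t = cdf P Z t) ->
      mutually_independent P' X ->
      st_le P' (X ord0) (fun w => \sum_(i < n.+1) theta i * X i w).

Definition increasing2 {R : realType} (phi : R * R -> R) : Prop :=
  forall a b : R * R, a.1 <= b.1 -> a.2 <= b.2 -> phi a <= phi b.

Definition convex2 {R : realType} (phi : R * R -> R) : Prop :=
  forall (a b : R * R) (l : R), 0 <= l -> l <= 1 ->
    phi (l * a.1 + (1 - l) * b.1, l * a.2 + (1 - l) * b.2)
      <= l * phi a + (1 - l) * phi b.

(* Main.v *)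
(* The law of an i.i.d. family is determined by its values on boxes, so the
   i.i.d. copies of phi(X, Y) can be realised as phi(X_i, Y_i) on a product
   A * B with the X_i i.i.d. on A and the Y_i i.i.d. on B.  There, Jensen gives
   sum_i theta_i phi(X_i, Y_i) >= phi(sum_i theta_i X_i, sum_i theta_i Y_i), and
   the two weighted sums are independent.  Since the sections of [phi <= t] are
   closed lower sets, integrating the hypotheses X <=_st sum_i theta_i X_i and
   Y <=_st sum_i theta_i Y_i one variable at a time (Tonelli) bounds the
   probability that the right-hand side is <= t by P(phi(X, Y) <= t). *)
Require Import Defs.
From HB Require Import structures.
From mathcomp Require Import all_boot all_order all_algebra.
From mathcomp Require Import all_classical all_reals all_analysis.
From mathcomp Require Import measurable_realfun ring lra.
Import Order.TTheory GRing.Theory Num.Theory.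
Local Open Scope classical_set_scope.
Local Open Scope ring_scope.
Set Implicit Arguments. Unset Strict Implicit.
Unset Printing Implicit Defensive.

(** * Laws of random variables and the classes of sets that determine them *)

Lemma preimage_itvNyc (R : realType) T (X : T -> R) t :
  [set w | X w <= t] = X @^-1` `]-oo, t].
Proof. by apply/seteqP; split=> w; rewrite /= in_itv. Qed.

Lemma measurable_preimageT d1 (T1 : measurableType d1) d2
    (T2 : measurableType d2) (f : T1 -> T2) A :
  measurable_fun setT f -> measurable A -> measurable (f @^-1` A).
Proof. by move=> mf mA; rewrite -[X in measurable X]setTI; exact: mf. Qed.

Lemma measurable_le_cst (R : realType) d (T : measurableType d) (X : T -> R) t :
  measurable_fun setT X -> measurable [set w | X w <= t].
Proof. by rewrite preimage_itvNyc => mX; exact: measurable_preimageT. Qed.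

Lemma distribution_of (R : realType) d (T : measurableType d)
    (P : probability T R) d' (S : measurableType d') (X : T -> S) :
  measurable_fun setT X ->
  exists mu : probability S R, forall A, mu A = P (X @^-1` A).
Proof.
move=> mX; pose X' : {mfun T >-> S} :=
  HB.pack X (isMeasurableFun.Build _ _ _ _ X mX).
by exists (distribution P X').
Qed.

(** Dynkin's argument: the sets on which the two image laws agree contain the whole space and are
    closed under complements and countable disjoint unions, so agreement spreads from the pi-system
    [G]. *)
Lemma eq_law_generator (R : realType) d0 (S : measurableType d0)
    (G : set (set S)) d1 (T1 : measurableType d1) (P1 : probability T1 R)
    d2 (T2 : measurableType d2) (P2 : probability T2 R)
    (f1 : T1 -> S) (f2 : T2 -> S) :
  @measurable _ S = <<s G >> -> setI_closed G ->
  measurable_fun setT f1 -> measurable_fun setT f2 ->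
  (forall A, G A -> P1 (f1 @^-1` A) = P2 (f2 @^-1` A)) ->
  forall A, measurable A -> P1 (f1 @^-1` A) = P2 (f2 @^-1` A).
Proof.
move=> mG GI mf1 mf2 eqG A; rewrite mG.
have m1 B : measurable B -> measurable (f1 @^-1` B).
  exact: measurable_preimageT.
have m2 B : measurable B -> measurable (f2 @^-1` B).
  exact: measurable_preimageT.
move: A; apply: dynkin_induction => //.
- by rewrite !preimage_setT !probability_setT.
- move=> B mB eqB.
  rewrite -!preimage_setC (probability_setC P1 (m1 _ mB)).
  by rewrite (probability_setC P2 (m2 _ mB)) eqB.
- move=> F mF tF eqF; rewrite !preimage_bigcup.
  have t T (f : T -> S) : trivIset setT (fun n => f @^-1` F n).
    apply/trivIsetP => i j _ _ ij; rewrite -preimage_setI.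
    by move/trivIsetP : tF => /(_ _ _ I I ij) ->; rewrite preimage_set0.
  rewrite (measure_bigcup P1 _ _ _ (t _ f1)); last by move=> i _; exact: m1.
  rewrite (measure_bigcup P2 _ _ _ (t _ f2)); last by move=> i _; exact: m2.
  by apply: eq_eseriesr => i _; exact: eqF.
Qed.

(** Open rays []x, +oo[] form a pi-system generating the Borel sets, and their complements are the
    events measured by the distribution function. *)
Lemma eq_law_cdf (R : realType)
    d1 (T1 : measurableType d1) (P1 : probability T1 R)
    d2 (T2 : measurableType d2) (P2 : probability T2 R)
    (X1 : T1 -> R) (X2 : T2 -> R) :
  measurable_fun setT X1 -> measurable_fun setT X2 ->
  (forall t, Defs.cdf P1 X1 t = Defs.cdf P2 X2 t) ->
  forall A : set R, measurable A -> P1 (X1 @^-1` A) = P2 (X2 @^-1` A).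
Proof.
move=> mX1 mX2 eqX.
apply: (eq_law_generator (G := @RGenOInfty.G R)) => //.
- exact: (RGenOInfty.measurableE R).
- move=> _ _ [x ->] [y ->]; exists (Num.max x y).
  by apply/seteqP; split=> z /=; rewrite !in_itv/= !andbT gt_max => /andP.
- move=> _ [x ->].
  have E d (T : measurableType d) (X : T -> R) :
      X @^-1` `]x, +oo[ = ~` [set w | X w <= x].
    by apply/seteqP; split=> w; rewrite /= in_itv/= andbT ltNge => /negP.
  rewrite !E (probability_setC P1 (measurable_le_cst _ mX1)).
  rewrite (probability_setC P2 (measurable_le_cst _ mX2)).
  by congr (_ - _)%E; exact: eqX.
Qed.

(** * Finite i.i.d. families: existence and uniqueness of the joint law *)

(** A single product formula encodes both independence and the common law [mu]; [S] is general so as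
    to cover pairs as well as reals. *)
Definition iid_law (R : realType) d0 (S : measurableType d0)
    (mu : probability S R) n d (T : measurableType d) (P : probability T R)
    (p : 'I_n -> T -> S) : Prop :=
  (forall i, measurable_fun setT (p i)) /\
  forall B : 'I_n -> set S, (forall i, measurable (B i)) ->
    P (\bigcap_(i in [set: 'I_n]) (p i @^-1` B i)) = (\prod_(i < n) mu (B i))%E.

Lemma iid_law_marginal (R : realType) d0 (S : measurableType d0)
    (mu : probability S R) n d (T : measurableType d) (P : probability T R)
    (p : 'I_n -> T -> S) : iid_law mu P p ->
  forall i A, measurable A -> P (p i @^-1` A) = mu A.
Proof.
move=> [_ pE] i A mA.
have := pE (fun j => if j == i then A else setT).
rewrite (bigD1 i)//= eqxx big1 ?mule1; last first.
  by move=> j /negPf ->; rewrite probability_setT.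
move=> <-; last by move=> j; case: ifP.
congr (P _); apply/seteqP; split=> [w Aw j _|w /(_ i I)]/=.
  by case: eqP => [->|].
by rewrite eqxx.
Qed.

(** Induction on [n]: a one-point space carries the empty family, and each further variable is read
    off a new factor [S] with law [mu]. *)
Lemma exists_iid_law (R : realType) d0 (S : measurableType d0)
    (mu : probability S R) n :
  exists d (T : measurableType d) (P : probability T R) (p : 'I_n -> T -> S),
    iid_law mu P p.
Proof.
elim: n => [|n [d [T [P [p [mp pE]]]]]].
  exists _, unit, (\d_tt : probability unit R), (fun i _ => point).
  split=> [[]//|B _]; rewrite big_ord0.
  rewrite (_ : \bigcap_(i in _) _ = setT) ?probability_setT//.
  by apply/seteqP; split=> // x _ [].
pose q (i : 'I_n.+1) (w : S * T) :=
  if unlift ord0 i is Some j then p j w.2 else w.1.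
exists _, (S * T)%type, (mu \x P)%E, q; split=> [i|B mB].
  rewrite /q; case: (unlift ord0 i) => [j|]; last exact: measurable_fst.
  by apply: (measurableT_comp (mp j)); exact: measurable_snd.
rewrite big_ord_recl -pE; last by move=> i; exact: mB.
rewrite -product_measure1E//; last first.
  apply: fin_bigcap_measurable; first exact: finite_finset.
  by move=> i _; exact: measurable_preimageT.
congr ((_ \x _)%E _); apply/seteqP; split=> -[x w]/=.
  move=> H; split=> /= [|i _].
    by have := H ord0 I; rewrite /q/= unlift_none.
  by have := H (lift ord0 i) I; rewrite /q /= liftK.
move=> [Bx H] i _; rewrite /q/=.
by case: (unliftP ord0 i) => [j ->|->//]; exact: H.
Qed.

(* Generates the product sigma-algebra on J -> S when J is finite. *)
Definition boxes (J : Type) d (S : measurableType d) : set (set (J -> S)) :=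
  [set A | exists2 B : J -> set S, (forall i, measurable (B i)) &
    A = [set f | forall i, B i (f i)]].

Lemma measurable_coordinate (J : Type) d (S : measurableType d) (i : J) :
  measurable_fun setT (fun f : g_sigma_algebraType (@boxes J d S) => f i).
Proof.
move=> _ A mA; rewrite setTI; apply: sub_sigma_algebra.
(* This box constrains coordinate [i] only; it is written as an implication because [J] carries no
   boolean equality. *)
exists (fun j => [set x | j = i -> A x]).
  move=> j; have [ji|ji] := pselect (j = i).
    rewrite (_ : [set _ | _] = A)//.
    by apply/seteqP; split=> x /=; [exact|move=> Ax _].
  by rewrite (_ : [set _ | _] = setT)//; apply/seteqP; split=> x // _ /ji.
by apply/seteqP; split=> f /=; [move=> Af j ->|exact].
Qed.

(** Boxes are stable under intersection, so agreement on them extends to the sigma-algebra they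
    generate; finiteness of [J] makes the preimage of a box a finite intersection. *)
Lemma eq_law_boxes (R : realType) (J : finType) d0 (S : measurableType d0)
    d1 (T1 : measurableType d1) (P1 : probability T1 R)
    d2 (T2 : measurableType d2) (P2 : probability T2 R)
    (U1 : J -> T1 -> S) (U2 : J -> T2 -> S) :
  (forall i, measurable_fun setT (U1 i)) ->
  (forall i, measurable_fun setT (U2 i)) ->
  (forall B : J -> set S, (forall i, measurable (B i)) ->
    P1 (\bigcap_(i in [set: J]) (U1 i @^-1` B i)) =
    P2 (\bigcap_(i in [set: J]) (U2 i @^-1` B i))) ->
  forall A : set (g_sigma_algebraType (@boxes J d0 S)), measurable A ->
    P1 [set w | A (U1^~ w)] = P2 [set w | A (U2^~ w)].
Proof.
move=> mU1 mU2 eqB.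
have bigcapE T (U : J -> T -> S) (B : J -> set S) :
    (fun w => U^~ w) @^-1` [set f | forall i, B i (f i)] =
    \bigcap_(i in [set: J]) (U i @^-1` B i).
  by apply/seteqP; split=> w H i => [_|]; [exact: H|exact: (H i I)].
have m d (T : measurableType d) (U : J -> T -> S) :
    (forall i, measurable_fun setT (U i)) -> measurable_fun setT
      (fun w => U^~ w : g_sigma_algebraType (@boxes J d0 S)).
  move=> mU; apply: measurability => //.
  move=> _ [_ [B mB ->] <-]; rewrite setTI bigcapE.
  apply: fin_bigcap_measurable; first exact: finite_finset.
  by move=> i _; exact: measurable_preimageT.
move=> A mA; apply: (@eq_law_generator R _ (g_sigma_algebraType (@boxes J d0 S))
  (@boxes J d0 S) _ _ P1 _ _ P2 _ _ erefl _ (m _ _ _ mU1) (m _ _ _ mU2) _ A mA).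
- move=> _ _ [B mB ->] [C mC ->]; exists (fun i => B i `&` C i).
    by move=> i; exact: measurableI.
  apply/seteqP; split=> f /=; first by case=> Bf Cf i; split.
  by move=> H; split=> i; case: (H i).
- by move=> _ [B mB ->]; rewrite !bigcapE; exact: eqB.
Qed.

(** * Semicontinuity and measurability of increasing convex functions *)

(** Convexity on the diagonal bounds the drop of [phi] over a backward step [s] by [s] times its
    rise over a unit forward step; a small [s] keeps this below the gap [phi (x, y) - t]. *)
Lemma convex2_left_lower_semicont (R : realType) (phi : R * R -> R) x y t :
  convex2 phi -> t < phi (x, y) -> exists2 s, 0 < s & t < phi (x - s, y - s).
Proof.
move=> cphi tlt.
(* [D] is positive and strictly above the rise over the unit step; [s] is then chosen so that
   [s * D] equals the gap above [t]. *)
pose D := `|phi (x + 1, y + 1) - phi (x, y)| + 1.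
have D0 : 0 < D by rewrite ltr_wpDl.
have Dge : phi (x + 1, y + 1) - phi (x, y) < D.
  by rewrite /D ltr_pwDr// ler_norm.
pose s := (phi (x, y) - t) / D.
have s0 : 0 < s by rewrite divr_gt0// subr_gt0.
exists s => //.
have sD : s * D = phi (x, y) - t by rewrite /s mulfVK// gt_eqF.
have s1 : 0 < 1 + s by lra.
pose l := (1 + s)^-1.
have l0 : 0 < l by rewrite invr_gt0.
have ls : l * (1 + s) = 1 by rewrite /l mulVf// gt_eqF.
have l1 : l <= 1 by nra.
(* (x, y) is the barycentre of (x - s, y - s) and (x + 1, y + 1) with weights
   l and 1 - l. *)
have := cphi (x - s, y - s) (x + 1, y + 1) l (ltW l0) l1.
rewrite /= (_ : l * (x - s) + _ = x); last by nra.
rewrite (_ : l * (y - s) + _ = y); last by nra.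
move: (phi (x - s, y - s)) (phi (x + 1, y + 1)) (phi (x, y)) Dge sD {tlt}.
move=> p1 p2 p0 Dge sD H.
(* Multiplying by [1 + s] turns convexity into [p0 - p1 <= s * (p2 - p0)], whose right side is below
   [s * D = p0 - t]. *)
have H2 : p0 * (1 + s) <= p1 + s * p2.
  have : p0 * (1 + s) <= (l * p1 + (1 - l) * p2) * (1 + s) by rewrite ler_pM2r.
  suff -> : (l * p1 + (1 - l) * p2) * (1 + s) = p1 + s * p2 by [].
  transitivity (l * (1 + s) * p1 + (1 + s - l * (1 + s)) * p2); first by ring.
  by rewrite ls; ring.
have : s * (p2 - p0) < s * D by rewrite ltr_pM2l.
by rewrite sD; nra.
Qed.

(* Monotone functions on the plane need not be Borel; left lower semicontinuity
   makes [phi > t] a union of quadrants with rational corners. *)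
Lemma measurable_increasing2_convex2 (R : realType) (phi : R * R -> R) :
  increasing2 phi -> convex2 phi -> measurable_fun setT phi.
Proof.
move=> iphi cphi.
apply: (measurability _ (RGenOInfty.measurableE R)) => _ [_ [t ->] <-].
rewrite setTI.
rewrite (_ : _ @^-1` _ = \bigcup_(p : rat) \bigcup_(q : rat)
    (if t < phi (ratr p, ratr q) then
      `[ratr p : R, +oo[ `*` `[ratr q : R, +oo[ else set0)).
  apply: bigcupT_measurable_rat => p; apply: bigcupT_measurable_rat => q.
  by case: ifP => // _; exact: measurableX.
apply/seteqP; split=> [[x y]|[x y] [p _ [q _]]]/=.
  rewrite in_itv/= andbT => /(convex2_left_lower_semicont cphi)[s s0 ts].
  have /rat_in_itvoo[p /itvP pE] : x - s < x by lra.
  have /rat_in_itvoo[q /itvP qE] : y - s < y by lra.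
  exists p => //; exists q => //.
  rewrite ifT; last by rewrite (lt_le_trans ts)// iphi//= ltW// (pE, qE).
  by split; rewrite /= in_itv/= andbT ltW// (pE, qE).
case: ifP => // tpq [] /=; rewrite !in_itv/= !andbT => px qy.
by rewrite (lt_le_trans tpq)// iphi.
Qed.

(** * Stochastic comparison on lower sets of the line and of the plane *)

(** The second hypothesis puts a finite supremum inside [E]: otherwise some smaller point would also
    lie outside [E] and be a smaller upper bound. *)
Lemma lower_set_closed (R : realType) (E : set R) :
  (forall x y, x <= y -> E y -> E x) ->
  (forall x, ~ E x -> exists2 y, y < x & ~ E y) ->
  [\/ E = set0, E = setT | exists a, E = `]-oo, a]%classic].
Proof.
move=> lowE openE.
have [E0|/set0P E0] := eqVneq E set0; first by constructor 1.
have [bE|nbE] := pselect (has_ubound E); last first.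
  constructor 2; apply/seteqP; split=> // x _; apply: contrapT => nEx.
  apply: nbE; exists x => z Ez; rewrite leNgt; apply/negP => /ltW xz.
  exact: nEx (lowE _ _ xz Ez).
constructor 3; exists (sup E); apply/seteqP; split=> x /=; rewrite in_itv/=.
  by move=> Ex; apply: ub_le_sup.
move=> xE; apply: contrapT => /openE[y yx nEy].
suff : sup E <= y by rewrite leNgt (lt_le_trans yx).
apply: ge_sup => // z Ez; rewrite leNgt; apply/negP => /ltW yz.
exact: nEy (lowE _ _ yz Ez).
Qed.

Lemma le_probability_lower_set (R : realType)
    (mu nu : probability R R) (E : set R) :
  (forall x y, x <= y -> E y -> E x) ->
  (forall x, ~ E x -> exists2 y, y < x & ~ E y) ->
  (forall a, mu `]-oo, a]%classic <= nu `]-oo, a]%classic)%E ->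
  (mu E <= nu E)%E.
Proof.
move=> lowE openE mn; have [->|->|[a ->]//] := lower_set_closed lowE openE.
  by rewrite !measure0.
by rewrite !probability_setT.
Qed.

(** The intermediate measure is [mu1 \x nu2]: the second marginal is exchanged first, on vertical
    sections, then the first one, on horizontal sections. *)
Lemma le_product_probability (R : realType)
    (mu1 mu2 nu1 nu2 : probability R R) (phi : R * R -> R) t :
  increasing2 phi -> convex2 phi ->
  (forall a, mu1 `]-oo, a]%classic <= mu2 `]-oo, a]%classic)%E ->
  (forall a, nu1 `]-oo, a]%classic <= nu2 `]-oo, a]%classic)%E ->
  ((mu1 \x nu1) [set z | phi z <= t]%R <=
   (mu2 \x nu2) [set z | phi z <= t]%R)%E.
Proof.
move=> iphi cphi le_mu le_nu; set D := [set z | _].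
have mD : measurable D.
  exact: measurable_le_cst (measurable_increasing2_convex2 iphi cphi).
have lowD z z' : z.1 <= z'.1 -> z.2 <= z'.2 -> D z' -> D z.
  by move=> le1 le2; apply: le_trans; exact: iphi.
have openD x y : ~ D (x, y) -> exists2 s, 0 < s & ~ D (x - s, y - s).
  move=> /negP; rewrite -ltNge => /(convex2_left_lower_semicont cphi)[s s0 ts].
  by exists s => //; apply/negP; rewrite -ltNge.
(* Tonelli for the indicator of [D]: the two iterated integrals agree on rectangles, hence on
   measurable sets. *)
have swapE (m1 m2 : probability R R) :
    (m1 \x m2)%E D = (m1 \x^ m2)%E D.
  by apply: product_measure_unique => //= *; rewrite product_measure2E.
apply: (@le_trans _ _ ((mu1 \x nu2)%E D)).
  apply: ge0_le_integral => //.
  - exact: measurable_fun_xsection.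
  - exact: measurable_fun_xsection.
  move=> x _ /=.
  rewrite xsectionE; apply: le_probability_lower_set => //= [y z yz|y].
    exact: lowD.
  (* [openD] moves diagonally while a section allows one coordinate to move; as [D] is a lower set,
     [(x, y - s)] lies outside it together with [(x - s, y - s)]. *)
  move=> /openD[s s0 nDs]; exists (y - s); first by lra.
  by apply: contra_not nDs; apply: lowD => //=; lra.
rewrite !swapE; apply: ge0_le_integral => //.
- exact: measurable_fun_ysection.
- exact: measurable_fun_ysection.
- move=> y _ /=.
  rewrite ysectionE; apply: le_probability_lower_set => //= [x z xz|x].
    exact: lowD.
  move=> /openD[s s0 nDs]; exists (x - s); first by lra.
  by apply: contra_not nDs; apply: lowD => //=; lra.
Qed.

(** * Jensen's inequality and weighted sums of i.i.d. copies *)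

(** Induction on the number of points: the first one is combined with the barycentre of the others,
    whose weights are renormalised by their sum [s]. *)
Lemma jensen2 (R : realType) (phi : R * R -> R) n (theta x y : 'I_n.+1 -> R) :
  convex2 phi -> (forall i, 0 <= theta i) -> \sum_(i < n.+1) theta i = 1 ->
  phi (\sum_(i < n.+1) theta i * x i, \sum_(i < n.+1) theta i * y i) <=
  \sum_(i < n.+1) theta i * phi (x i, y i).
Proof.
move=> cphi; elim: n theta x y => [|n IH] theta x y t0.
  by rewrite !big_ord1 => ->; rewrite !mul1r.
rewrite !(big_ord_recl n.+1) => t1.
set s := \sum_(i < n.+1) theta (lift ord0 i).
have s0 : 0 <= s by apply: sumr_ge0.
have tE : theta ord0 = 1 - s by rewrite -t1 addrK.
(* If [s] is zero, renormalising is impossible, but then all remaining weights vanish and only the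
   first term survives. *)
have [s_eq0|s_neq0] := eqVneq s 0.
  have tz i : theta (lift ord0 i) = 0.
    have := psumr_eq0P (fun i _ => t0 (lift ord0 i)) s_eq0; exact.
  by rewrite tE s_eq0 subr0 !mul1r !big1 ?addr0// => i _; rewrite tz mul0r.
have sumE (z : 'I_n.+2 -> R) :
    \sum_(i < n.+1) theta (lift ord0 i) * z (lift ord0 i) =
    s * \sum_(i < n.+1) theta (lift ord0 i) / s * z (lift ord0 i).
  rewrite mulr_sumr; apply: eq_bigr => i _.
  by rewrite mulrA mulrCA divff// mulr1.
rewrite (sumE x) (sumE y) (sumE (fun i => phi (x i, y i))).
have th1 : 1 - theta ord0 = s by rewrite tE opprB addrCA subrr addr0.
have := cphi (x ord0, y ord0)
  (\sum_(i < n.+1) theta (lift ord0 i) / s * x (lift ord0 i),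
   \sum_(i < n.+1) theta (lift ord0 i) / s * y (lift ord0 i))
  (theta ord0) (t0 _) _.
rewrite /= th1 => /(_ _)/le_trans; apply; first by rewrite tE lerBlDr lerDl.
rewrite lerD2l ler_wpM2l// IH//.
- by move=> i; rewrite divr_ge0.
- by rewrite -mulr_suml divff.
Qed.

(** Independence is the product formula on rectangles, which determines the product measure. *)
Lemma independent2_law (R : realType) d (T : measurableType d)
    (P : probability T R) (X Y : T -> R) (mu nu : probability R R) :
  measurable_fun setT X -> measurable_fun setT Y -> independent2 P X Y ->
  (forall A, mu A = P (X @^-1` A)) -> (forall A, nu A = P (Y @^-1` A)) ->
  forall D, measurable D -> (mu \x nu)%E D = P [set w | D (X w, Y w)].
Proof.
move=> mX mY iXY muE nuE D mD.
have [m mE] := distribution_of P (measurable_fun_pair mX mY).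
rewrite -[RHS]mE; apply: product_measure_unique => //= A B mA mB.
by rewrite mE muE nuE -iXY.
Qed.

Lemma Dminus_iid_law (R : realType) d (T : measurableType d)
    (P : probability T R) (X : T -> R) (mu : probability R R)
    n (theta : 'I_n.+1 -> R) d' (T' : measurableType d')
    (P' : probability T' R) (x : 'I_n.+1 -> T' -> R) :
  Dminus P X -> (forall A, mu A = P (X @^-1` A)) ->
  (forall i, 0 <= theta i) -> \sum_(i < n.+1) theta i = 1 ->
  iid_law mu P' x -> forall t,
  (P' ((fun w => \sum_(i < n.+1) theta i * x i w)%R @^-1` `]-oo, t]) <=
   mu `]-oo, t]%classic)%E.
Proof.
move=> [mX DX] muE th0 th1 xE t.
have marg := iid_law_marginal xE.
case: xE => mx xE.
rewrite -preimage_itvNyc -(marg ord0)// -preimage_itvNyc.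
apply: (DX n theta) => // [i s|B mB].
  by rewrite /Defs.cdf (preimage_itvNyc (x i)) (preimage_itvNyc X) marg.
by rewrite xE//; apply: eq_bigr => i _; rewrite marg.
Qed.

Lemma measurable_weighted_sum (R : realType) d (T : measurableType d) n
    (theta : 'I_n -> R) (f : 'I_n -> T -> R) :
  (forall i, measurable_fun setT (f i)) ->
  measurable_fun setT (fun w => \sum_(i < n) theta i * f i w).
Proof.
by move=> mf; apply: measurable_sum => i; exact: measurable_funM.
Qed.

(** Splitting each pair into its coordinates gives a family of reals indexed by ['I_n + 'I_n]; its
    box probabilities factor in the same way on [W] and on [A * B], so the two joint laws
    coincide. *)
Lemma iid_law_pairs (R : realType) (phi : R * R -> R) n (theta : 'I_n -> R) t
    (mu nu : probability R R)
    dW (W : measurableType dW) (PW : probability W R) (w : 'I_n -> W -> R * R)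
    dA (A : measurableType dA) (PA : probability A R) (x : 'I_n -> A -> R)
    dB (B : measurableType dB) (PB : probability B R) (y : 'I_n -> B -> R) :
  measurable_fun setT phi ->
  iid_law (mu \x nu)%E PW w -> iid_law mu PA x -> iid_law nu PB y ->
  PW [set v | \sum_(i < n) theta i * phi (w i v) <= t] =
  (PA \x PB)%E
    [set z | \sum_(i < n) theta i * phi (x i z.1, y i z.2) <= t].
Proof.
move=> mphi [mw wE] [mx xE] [my yE].
pose U1 (j : 'I_n + 'I_n) v :=
  match j with inl i => (w i v).1 | inr i => (w i v).2 end.
pose U2 (j : 'I_n + 'I_n) (z : A * B) :=
  match j with inl i => x i z.1 | inr i => y i z.2 end.
pose V := g_sigma_algebraType (@boxes ('I_n + 'I_n)%type _ R).
have mC : measurable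
    [set f : V | \sum_(i < n) theta i * phi (f (inl i), f (inr i)) <= t].
  apply: measurable_le_cst; apply: measurable_weighted_sum => i.
  apply: (measurableT_comp mphi); apply: measurable_fun_pair;
  exact: measurable_coordinate.
transitivity (PW [set v | [set f : V |
    \sum_(i < n) theta i * phi (f (inl i), f (inr i)) <= t] (U1^~ v)]).
  congr (PW _); apply/funext => v /=; congr (is_true (_ <= t)).
  by apply: eq_bigr => i _; rewrite -surjective_pairing.
rewrite (@eq_law_boxes R _ _ R _ _ PW _ _ (PA \x PB)%E U1 U2)//.
- move=> [i|i].
  + exact: (measurableT_comp measurable_fst (mw i)).
  + exact: (measurableT_comp measurable_snd (mw i)).
- move=> [i|i].
  + exact: (measurableT_comp (mx i) measurable_fst).
  + exact: (measurableT_comp (my i) measurable_snd).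
- move=> C mC'.
  rewrite (_ : \bigcap_(j in _) _ =
      \bigcap_(i in setT) (w i @^-1` (C (inl i) `*` C (inr i)))); last first.
    apply/seteqP; split=> v H; first by move=> i _; split; exact: (H _ I).
    by move=> [i|i] _; case: (H i I).
  rewrite wE; last by move=> i; exact: measurableX.
  rewrite (_ : \bigcap_(j in _) _ =
      (\bigcap_(i in setT) (x i @^-1` C (inl i))) `*`
      (\bigcap_(i in setT) (y i @^-1` C (inr i)))); last first.
    apply/seteqP; split=> -[a b].
      by move=> H; split=> i _; [exact: (H (inl i) I)|exact: (H (inr i) I)].
    by move=> [Ha Hb] [i|i] _; [exact: (Ha i I)|exact: (Hb i I)].
  rewrite /= product_measure1E; last 2 first.
  + apply: fin_bigcap_measurable; first exact: finite_finset.
    by move=> i _; exact: measurable_preimageT.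
  + apply: fin_bigcap_measurable; first exact: finite_finset.
    by move=> i _; exact: measurable_preimageT.
  transitivity (PA (\bigcap_(i in setT) (x i @^-1` C (inl i))) *
    PB (\bigcap_(i in setT) (y i @^-1` C (inr i))))%E => [|//].
  rewrite xE// yE// -big_split/=.
  by apply: eq_bigr => i _; exact: product_measure1E.
Qed.

Unset Implicit Arguments.

Theorem theorem1 (R : realType) (d : measure_display) (T : measurableType d)
  (P : probability T R) (X Y : T -> R) (phi : R * R -> R) :
  independent2 P X Y -> Dminus P X -> Dminus P Y ->
  increasing2 phi -> convex2 phi ->
  Dminus P (fun w => phi (X w, Y w)).
Proof.
move=> iXY DX DY iphi cphi.
have [mX mY] : measurable_fun setT X /\ measurable_fun setT Y.
  by split; [case: DX|case: DY].
have mphi := measurable_increasing2_convex2 iphi cphi.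
have mZ : measurable_fun setT (fun w => phi (X w, Y w)).
  exact: (measurableT_comp mphi (measurable_fun_pair mX mY)).
split=> // n theta th0 th1 d' T' P' Z mZi cdfZ indZ t.
have [mu muE] := distribution_of P mX.
have [nu nuE] := distribution_of P mY.
have lawXY := independent2_law mX mY iXY muE nuE.
(* The i.i.d. pairs on [W] link [Z], through [phi], to the coordinates carried separately by [A] and
   [B]. *)
have [dW [W [PW [w wE]]]] := exists_iid_law (mu \x nu)%E n.+1.
have [dA [A [PA [x xE]]]] := exists_iid_law mu n.+1.
have [dB [B [PB [y yE]]]] := exists_iid_law nu n.+1.
have [mw wE2] := wE; have [mx _] := xE; have [my _] := yE.
pose V := g_sigma_algebraType (@boxes 'I_n.+1 _ R).
have mC : measurable [set f : V | \sum_(i < n.+1) theta i * f i <= t].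
  apply: measurable_le_cst; apply: measurable_weighted_sum => i.
  exact: measurable_coordinate.
have mphiw i : measurable_fun setT (fun v => phi (w i v)).
  exact: (measurableT_comp mphi (mw i)).
(* [Z] is known only through its distribution functions and independence; these fix its box
   probabilities, hence the law of the weighted sum. *)
have -> : Defs.cdf P' (fun v => \sum_(i < n.+1) theta i * Z i v) t =
    PW [set v | \sum_(i < n.+1) theta i * phi (w i v) <= t].
  apply: (eq_law_boxes mZi mphiw _ mC) => C mC'.
  rewrite indZ// (_ : \bigcap_(i in _) ((fun v => _) @^-1` _) =
    \bigcap_(i in setT) (w i @^-1` (phi @^-1` C i)))// wE2; last first.
    by move=> i; exact: measurable_preimageT.
  apply: eq_bigr => i _.
  transitivity (P [set v | (phi @^-1` C i) (X v, Y v)]).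
    exact: (eq_law_cdf (mZi i) mZ (cdfZ i)).
  by apply/esym/lawXY; exact: measurable_preimageT.
have -> : Defs.cdf P' (Z ord0) t = (mu \x nu)%E [set z | phi z <= t].
  by rewrite cdfZ lawXY//; exact: measurable_le_cst.
rewrite (iid_law_pairs _ _ mphi wE xE yE).
pose SX a := \sum_(i < n.+1) theta i * x i a.
pose SY b := \sum_(i < n.+1) theta i * y i b.
have mSX : measurable_fun setT SX by exact: measurable_weighted_sum.
have mSY : measurable_fun setT SY by exact: measurable_weighted_sum.
have mSX1 := measurableT_comp mSX (@measurable_fst _ _ A B).
have mSY2 := measurableT_comp mSY (@measurable_snd _ _ A B).
(* Both laws are taken on the product space, where the two sums become independent variables. *)
have [muS muSE] := distribution_of (PA \x PB)%E mSX1.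
have [nuS nuSE] := distribution_of (PA \x PB)%E mSY2.
have fstE C : measurable C ->
    (PA \x PB)%E ((SX \o fst) @^-1` C) = PA (SX @^-1` C).
  move=> mC'; rewrite comp_preimage -setXT product_measure1E//.
    by rewrite /= probability_setT mule1.
  exact: measurable_preimageT.
have sndE C : measurable C ->
    (PA \x PB)%E ((SY \o snd) @^-1` C) = PB (SY @^-1` C).
  move=> mC'; rewrite comp_preimage -setTX product_measure1E//.
    by rewrite /= probability_setT mul1e.
  exact: measurable_preimageT.
(* The middle term is the probability that [phi (SX, SY) <= t]: the stochastic orders bound it
   above, and Jensen's inclusion of events bounds it below. *)
apply: (@le_trans _ _ ((muS \x nuS)%E [set z | phi z <= t])); last first.
  apply: le_product_probability => // a.
    rewrite (etrans (muSE _) (fstE _ _))//.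
    exact: Dminus_iid_law DX muE th0 th1 xE a.
  rewrite (etrans (nuSE _) (sndE _ _))//.
  exact: Dminus_iid_law DY nuE th0 th1 yE a.
have iS : independent2 (PA \x PB)%E (SX \o fst) (SY \o snd).
  move=> C D mC' mD; transitivity (PA (SX @^-1` C) * PB (SY @^-1` D))%E.
    by apply: product_measure1E; exact: measurable_preimageT.
  by congr (_ * _)%E; apply/esym; [exact: fstE|exact: sndE].
rewrite (independent2_law mSX1 mSY2 iS muSE nuSE);
  last exact: measurable_le_cst.
apply: le_measure; rewrite ?inE.
- apply: measurable_le_cst; apply: measurable_weighted_sum => i.
  apply: (measurableT_comp mphi); apply: measurable_fun_pair.
  + exact: (measurableT_comp (mx i) measurable_fst).
  + exact: (measurableT_comp (my i) measurable_snd).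
- apply: measurable_le_cst.
  exact: (measurableT_comp mphi (measurable_fun_pair mSX1 mSY2)).
- by move=> z; apply: le_trans; exact: jensen2.
Qed.
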